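(* Let $R$ be a valuation ring with maximal ideal $P$, and assume that $Z\neq 0$, where $Z$ is the set of zero-divisors of $R$. Then the following conditions are equivalent: (1) each product of singly projective $R$-modules is singly projective; (2) $R^R$ (the product of copies of $R$ indexed by the set $R$) is singly projective; (3) $C^*=\mathrm{Hom}_R(C,R)$ is a finitely generated module for each cyclic $R$-module $C$; (4) the annihilator $(0:A)$ is finitely generated for each proper ideal $A$ of $R$; (5) $P$ is principal or faithful, and for each ideal $A$ of $R$ there exists $a\in R$ such that either $A=Ra$ or $A=Pa$; (6) each ideal of $R$ is countably generated and $R^{\mathbb{N}}$ is singly projective; (7) each product of flat content $R$-modules is flat content; (8) $R^R$ is a flat content module; (9) each ideal of $R$ is countably generated and $R^{\mathbb{N}}$ is a flat content module; (10) $P$ is principal or faithful, and the intersection of any non-empty family of principal ideals of $R$ is finitely generated.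
   Context: A valuation ring is a commutative ring $R$ (possibly with zero-divisors) whose set of ideals is totally ordered by inclusion. $Z=\{s\in R\mid \exists\, 0\ne x\in R,\ sx=0\}$, so $Z\ne 0$ means that $R$ is not a domain. An ideal is faithful if its annihilator is $0$. An $R$-module $M$ is singly projective if, for any cyclic submodule $N$ of $M$, the inclusion map $N\to M$ factors through a free module. For $x\in M$, the content ideal $\mathrm{c}(x)$ is the intersection of all ideals $A$ of $R$ for which $x\in AM$; $M$ is a content module if $x\in\mathrm{c}(x)M$ for all $x\in M$; a flat content module is a module that is both flat and content. *)

(* Defs.v *)
From HB Require Import structures.
From mathcomp Require Import all_boot all_algebra sesquilinear generic_quotient.
From mathcomp Require Import mathcomp_extra boolp classical_sets functions.
From mathcomp Require Import cardinality.
Set Implicit Arguments.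
Unset Strict Implicit.
Unset Printing Implicit Defensive.
Import GRing.Theory.
Local Open Scope classical_set_scope.
Local Open Scope ring_scope.
Local Open Scope quotient_scope.

Section Submodules.
Variables (R : comNzRingType) (M : lmodType R).
Implicit Types N S : set M.

Definition submodule N : Prop := submod_closed [in N].

Definition submodule_span S : set M := smallest submodule S.

Definition cyclic_span (x : M) : set M := range (fun r : R => r *: x).

Definition cyclic N : Prop := exists x, N = cyclic_span x.

Definition finitely_generated N : Prop :=
  exists2 S, finite_set S & N = submodule_span S.

Definition countably_generated N : Prop :=
  exists2 S, countable S & N = submodule_span S.

Record submod N (hN : submodule N) := Submod {
  submod_val :> M;
  submod_valP : submod_val \in N }.

HB.instance Definition _ N (hN : submodule N) :=
  [isSub for @submod_val N hN].
HB.instance Definition _ N (hN : submodule N) := [Choice of submod hN by <:].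
HB.instance Definition _ N (hN : submodule N) :=
  GRing.SubChoice_isSubLmodule.Build R M [in N] (submod hN)
    (GRing.submod_closed_semi hN).

Definition linearly_independent (B : set M) : Prop :=
  forall (s : seq M) (c : M -> R), uniq s -> [set` s] `<=` B ->
    \sum_(v <- s) c v *: v = 0 -> forall v, v \in s -> c v = 0.

Definition free_module : Prop :=
  exists B : set M, linearly_independent B /\ submodule_span B = [set: M].

End Submodules.

Definition singly_projective (R : comNzRingType) (M : lmodType R) : Prop :=
  forall (N : set M) (hN : submodule N), cyclic N ->
  exists (F : lmodType R) (f : {linear submod hN -> F}) (g : {linear F -> M}),
    free_module F /\ forall y : submod hN, g (f y) = val y.

Section Product.
Variables (R : comNzRingType) (I : Type) (M : I -> lmodType R).

Definition prod_module : Type := forall i, M i.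

HB.instance Definition _ := gen_eqMixin prod_module.
HB.instance Definition _ := gen_choiceMixin prod_module.

Implicit Types f g h : prod_module.

Let zero : prod_module := fun=> 0.
Let opp f : prod_module := fun i => - f i.
Let add f g : prod_module := fun i => f i + g i.
Let scale (a : R) f : prod_module := fun i => a *: f i.

Let addA : associative add.
Proof.
by move=> f g h; apply: functional_extensionality_dep => i; exact: addrA.
Qed.
Let addC : commutative add.
Proof.
by move=> f g; apply: functional_extensionality_dep => i; exact: addrC.
Qed.
Let add0 : left_id zero add.
Proof.
by move=> f; apply: functional_extensionality_dep => i; exact: add0r.
Qed.
Let addN : left_inverse zero opp add.
Proof.
by move=> f; apply: functional_extensionality_dep => i; exact: addNr.
Qed.

HB.instance Definition _ :=
  GRing.isZmodule.Build prod_module addA addC add0 addN.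

Let scaleA a b f : scale a (scale b f) = scale (a * b) f.
Proof. by apply: functional_extensionality_dep => i; exact: scalerA. Qed.
Let scale1 : left_id 1 scale.
Proof.
by move=> f; apply: functional_extensionality_dep => i; exact: scale1r.
Qed.
Let scaleDr : right_distributive scale +%R.
Proof.
by move=> a f g; apply: functional_extensionality_dep => i; exact: scalerDr.
Qed.
Let scaleDl f : {morph scale^~ f : a b / a + b}.
Proof.
by move=> a b; apply: functional_extensionality_dep => i; exact: scalerDl.
Qed.

HB.instance Definition _ :=
  GRing.Zmodule_isLmodule.Build R prod_module scaleA scale1 scaleDr scaleDl.

End Product.

Section Hom.
Variables (R : comNzRingType) (U V : lmodType R).

Definition hom_module : Type := {linear U -> V}.

HB.instance Definition _ := gen_eqMixin hom_module.
HB.instance Definition _ := gen_choiceMixin hom_module.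

Implicit Types f g h : hom_module.

Identity Coercion linear_of_hom : hom_module >-> GRing.Linear.type.

Lemma hom_eqP f g : f =1 g -> f = g.
Proof.
case: f g => [f [[[f1 f2]] [f3]]] [g [[[g1 g2]] [g3]]] /= /funext fg.
move: f1 f2 f3; rewrite fg => f1 f2 f3.
by rewrite (Prop_irrelevance f1 g1) (Prop_irrelevance f2 g2)
  (Prop_irrelevance f3 g3).
Qed.

Let zero : hom_module := \0 : {linear U -> V}.
Let opp f : hom_module := \- f : {linear U -> V}.
Let add f g : hom_module := f \+ g : {linear U -> V}.
Let scale (a : R) f : hom_module := a \*: f : {linear U -> V}.

Let addA : associative add.
Proof. by move=> f g h; apply: hom_eqP => u; exact: addrA. Qed.
Let addC : commutative add.
Proof. by move=> f g; apply: hom_eqP => u; exact: addrC. Qed.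
Let add0 : left_id zero add.
Proof. by move=> f; apply: hom_eqP => u; exact: add0r. Qed.
Let addN : left_inverse zero opp add.
Proof. by move=> f; apply: hom_eqP => u; exact: addNr. Qed.

HB.instance Definition _ :=
  GRing.isZmodule.Build hom_module addA addC add0 addN.

Let scaleA a b f : scale a (scale b f) = scale (a * b) f.
Proof. by apply: hom_eqP => u; exact: scalerA. Qed.
Let scale1 : left_id 1 scale.
Proof. by move=> f; apply: hom_eqP => u; exact: scale1r. Qed.
Let scaleDr : right_distributive scale +%R.
Proof. by move=> a f g; apply: hom_eqP => u; exact: scalerDr. Qed.
Let scaleDl f : {morph scale^~ f : a b / a + b}.
Proof. by move=> a b; apply: hom_eqP => u; exact: scalerDl. Qed.

HB.instance Definition _ :=
  GRing.Zmodule_isLmodule.Build R hom_module scaleA scale1 scaleDr scaleDl.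

End Hom.

Definition dual (R : comNzRingType) (C : lmodType R) : lmodType R :=
  hom_module C R^o.

Section Tensor.
Variables (R : comNzRingType).

(* (T, t) is a tensor product of A and M over R: t is the universal bilinear
   map on A x M. *)
Definition is_tensor_product (A M T : lmodType R)
    (t : {bilinear A -> M -> T}) : Prop :=
  forall (W : lmodType R) (b : {bilinear A -> M -> W}),
    exists h : {linear T -> W}, (forall a m, h (t a m) = b a m) /\
      forall h' : {linear T -> W}, (forall a m, h' (t a m) = b a m) -> h' =1 h.

End Tensor.

Section TensorExistence.
Variables (R : comNzRingType) (A M : lmodType R).

(* Since flatness quantifies over all tensor products, it matters that they
   exist. Here [tensor] is the type of formal sums of pairs (a, m), two of them
   being identified when no bilinear map separates them. *)
Let pre : choiceType := seq (A * M).
Let sumb (W : lmodType R) (b : A -> M -> W) (s : pre) : W :=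
  \sum_(p <- s) b p.1 p.2.
Let rel0 (s1 s2 : pre) : bool :=
  `[< forall (W : lmodType R) (b : {bilinear A -> M -> W}),
      sumb b s1 = sumb b s2 >].

Implicit Types W : lmodType R.
Let rel0_refl : reflexive rel0. Proof. by move=> s; apply/asboolP. Qed.
Let rel0_sym : symmetric rel0.
Proof. by move=> s t; apply/asboolP/asboolP => h W b; rewrite h. Qed.
Let rel0_trans : transitive rel0.
Proof.
by move=> t s u /asboolP h1 /asboolP h2; apply/asboolP => W b; rewrite h1.
Qed.
Let eqv := EquivRel rel0 rel0_refl rel0_sym rel0_trans.
Definition tensor : Type := {eq_quot eqv}.
HB.instance Definition _ := Choice.on tensor.

Let mk (s : pre) : tensor := \pi_({eq_quot eqv}) s.
Let rp (x : tensor) : pre := repr (x : {eq_quot eqv}).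
Let rpK x : mk (rp x) = x. Proof. exact: reprK. Qed.

Let ev (W : lmodType R) (b : {bilinear A -> M -> W}) (x : tensor) : W :=
  sumb b (rp x).

Let evE (W : lmodType R) (b : {bilinear A -> M -> W}) s : ev b (mk s) = sumb b s.
Proof.
have /eqquotP/asboolP h :
    \pi_({eq_quot eqv}) (rp (mk s)) = \pi_({eq_quot eqv}) s.
  exact: rpK.
by apply: h.
Qed.

Let tensorP x y :
  (forall (W : lmodType R) (b : {bilinear A -> M -> W}), ev b x = ev b y) ->
  x = y.
Proof.
move=> h; rewrite -(rpK x) -(rpK y).
by apply/eqquotP/asboolP.
Qed.

Let zero := mk [::].
Let add x y := mk (rp x ++ rp y).
Let scale (a : R) x := mk [seq (a *: p.1, p.2) | p <- rp x].
Let opp x := scale (-1) x.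

Let ev0 W b : @ev W b zero = 0. Proof. by rewrite evE /sumb big_nil. Qed.
Let evD W b x y : @ev W b (add x y) = ev b x + ev b y.
Proof. by rewrite evE /sumb big_cat. Qed.
Let evZ W b a x : @ev W b (scale a x) = a *: ev b x.
Proof.
rewrite evE /sumb big_map scaler_sumr; apply: eq_bigr => p _ /=.
by rewrite linearZl_LR.
Qed.

Let addA : associative add.
Proof. by move=> *; apply: tensorP => W b; rewrite !evD addrA. Qed.
Let addC : commutative add.
Proof. by move=> *; apply: tensorP => W b; rewrite !evD addrC. Qed.
Let add0 : left_id zero add.
Proof. by move=> *; apply: tensorP => W b; rewrite !evD ev0 add0r. Qed.
Let addN : left_inverse zero opp add.
Proof.
by move=> *; apply: tensorP => W b; rewrite !evD evZ ev0 scaleN1r addNr.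
Qed.
HB.instance Definition _ := GRing.isZmodule.Build tensor addA addC add0 addN.
Let scaleA a b x : scale a (scale b x) = scale (a * b) x.
Proof. by apply: tensorP => W c; rewrite !evZ scalerA. Qed.
Let scale1 : left_id 1 scale.
Proof. by move=> *; apply: tensorP => W c; rewrite !evZ scale1r. Qed.
Let scaleDr : right_distributive scale +%R.
Proof. by move=> *; apply: tensorP => W c; rewrite !(evZ, evD) scalerDr. Qed.
Let scaleDl x : {morph scale^~ x : a b / a + b}.
Proof. by move=> *; apply: tensorP => W c; rewrite !(evZ, evD) scalerDl. Qed.
HB.instance Definition _ :=
  GRing.Zmodule_isLmodule.Build R tensor scaleA scale1 scaleDr scaleDl.

Definition pure (a : A) (m : M) : tensor := mk [:: (a, m)].
Let ev_pure W b a m : @ev W b (pure a m) = b a m.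
Proof. by rewrite evE /sumb big_seq1. Qed.

Let pure_bilinear : bilinear_for
  (GRing.Scale.Law.clone _ _ *:%R _) (GRing.Scale.Law.clone _ _ *:%R _) pure.
Proof.
split=> [m a x y|a c x y]; apply: tensorP => W b.
  by rewrite evD evZ !ev_pure linearPl.
by rewrite evD evZ !ev_pure linearPr.
Qed.
HB.instance Definition _ :=
  bilinear_isBilinear.Build R A M tensor _ _ pure pure_bilinear.

Let ev_linear W b : linear (@ev W b).
Proof. by move=> a x y; rewrite evD evZ. Qed.

Lemma pure_is_tensor_product :
  is_tensor_product (pure : {bilinear A -> M -> tensor}).
Proof.
move=> W b.
pose hm := GRing.isLinear.Build R tensor W _ (@ev W b) (ev_linear b).
pose h : {linear tensor -> W} := HB.pack (@ev W b) hm.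
exists h; split=> [a m|h' Hh' x]; first exact: ev_pure.
have -> : x = \sum_(p <- rp x) pure p.1 p.2.
  apply: tensorP => V c.
  pose hm' := GRing.isLinear.Build R tensor V _ (@ev V c) (ev_linear c).
  pose g : {linear tensor -> V} := HB.pack (@ev V c) hm'.
  rewrite -[RHS]/(g _) linear_sum; apply: eq_bigr => p _.
  by rewrite /= ev_pure.
rewrite !linear_sum; apply: eq_bigr => p _.
by rewrite Hh' /= ev_pure.
Qed.

Lemma tensor_product_exists :
  exists (T : lmodType R) (t : {bilinear A -> M -> T}), is_tensor_product t.
Proof. by exists tensor, pure; exact: pure_is_tensor_product. Qed.

End TensorExistence.

(* h is the map f (x) id_M, for any choice of the two tensor products. *)
Definition flat (R : comNzRingType) (M : lmodType R) : Prop :=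
  forall (A B : lmodType R) (f : {linear A -> B}), injective f ->
  forall (TA TB : lmodType R)
    (tA : {bilinear A -> M -> TA}) (tB : {bilinear B -> M -> TB}),
    is_tensor_product tA -> is_tensor_product tB ->
  forall h : {linear TA -> TB}, (forall a m, h (tA a m) = tB (f a) m) ->
    injective h.

Section Ideals.
Variable R : comNzRingType.
Implicit Types A P : set R^o.

(* Subsets of R are typed as sets of elements of R^o, so that the notions on
   submodules apply to ideals; r *: a is r * a there. *)
Definition ideal A : Prop := submodule A.

Definition principal A : Prop := cyclic A.

Definition valuation_ring : Prop :=
  forall A B : set R^o, ideal A -> ideal B -> A `<=` B \/ B `<=` A.

Definition maximal_ideal P : Prop :=
  [/\ ideal P, P <> setT &
    forall A, ideal A -> P `<=` A -> A = P \/ A = setT].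

Definition zero_divisors : set R^o :=
  [set s | exists x : R, x <> 0 /\ s * x = 0].

Definition annihilator A : set R^o := [set r | forall a, A a -> r * a = 0].

Definition faithful A : Prop := annihilator A = [set 0].

Definition ideal_mulr P (a : R) : set R^o := [set p * a | p in P].

Section Content.
Variable M : lmodType R.

Definition ideal_scale A : set M :=
  submodule_span [set (a : R) *: m | a in A & m in [set: M]].

Definition content (x : M) : set R^o :=
  \bigcap_(A in [set A | ideal A /\ ideal_scale A x]) A.

Definition content_module : Prop :=
  forall x : M, ideal_scale (content x) x.

Definition flat_content : Prop := flat M /\ content_module.

End Content.

End Ideals.

Arguments zero_divisors R : clear implicits.

(* Main.v *)
(* Over a valuation ring, a module is singly projective iff every x is a m with
   (0 : x) = (0 : a); flat iff r x = 0 implies x = c m with r c = 0; and content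
   iff every x is a m with b dividing a whenever x = b n. For a power of R, the
   first criterion says that each ideal A with enough generators available lies
   in some Ra with (0 : A) = (0 : a). Applied to (0 : A), which is the dual of
   R/A, this makes every annihilator principal. By Nakayama, P then consists of
   zero-divisors, so (0 : pa) = (0 : a) with p in P forces a = 0. Hence an ideal
   A inside Rc with (0 : A) = (0 : c) is Rc or Pc, which is (5). Conversely (5)
   provides such an a for all ideals, so products of singly projective modules
   are singly projective; and as P = Z, singly projective modules are the flat
   content ones, and principal ideals, being annihilators, have principal
   intersections. Finally, the union of a strictly increasing sequence of
   principal ideals inside P is some Pa, so P is countably generated. *)
Require Import Defs.
From HB Require Import structures.
From mathcomp Require Import all_boot all_algebra sesquilinear generic_quotient.
From mathcomp Require Import boolp classical_sets cardinality.
Set Implicit Arguments.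
Unset Strict Implicit.
Unset Printing Implicit Defensive.
Import GRing.Theory.
Local Open Scope classical_set_scope.
Local Open Scope ring_scope.

(** * Bundled linear and bilinear maps; submodules and spans *)

Section LinearMaps.
Variable R : comNzRingType.
Implicit Types U V W : lmodType R.

Lemma linear_exists U V (f : U -> V) : linear f ->
  exists g : {linear U -> V}, forall u, g u = f u.
Proof.
move=> lf.
pose h := GRing.isLinear.Build R U V _ f lf.
pose g : {linear U -> V} := HB.pack f h.
by exists g.
Qed.

Lemma bilinear_exists U V W (f : U -> V -> W) :
    (forall v, linear (f^~ v)) -> (forall u, linear (f u)) ->
  exists g : {bilinear U -> V -> W}, forall u v, g u v = f u v.
Proof.
move=> lf rf.
have bf : bilinear_for
    (GRing.Scale.Law.clone _ _ *:%R _) (GRing.Scale.Law.clone _ _ *:%R _) f.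
  by split=> [v a x y|u a x y]; [exact: lf|exact: rf].
pose h := bilinear_isBilinear.Build R U V W _ _ f bf.
pose g : {bilinear U -> V -> W} := HB.pack f h.
by exists g.
Qed.

Lemma submoduleP U (N : set U) :
  submodule N <-> N 0 /\ forall a u v, N u -> N v -> N (a *: u + v).
Proof.
split=> [[N0 NP]|[N0 NP]].
  by split=> [|a u v /mem_set Nu /mem_set Nv]; apply: set_mem;
    [exact: N0|exact: NP].
split=> [|a u v]; first exact: mem_set.
by move=> /set_mem Nu /set_mem Nv; apply/mem_set/NP.
Qed.

Lemma submodule0 U (N : set U) : submodule N -> N 0.
Proof. by case/submoduleP. Qed.

Lemma submoduleD U (N : set U) : submodule N ->
  forall u v, N u -> N v -> N (u + v).
Proof. by case/submoduleP => _ h u v Nu Nv; rewrite -[u]scale1r; exact: h. Qed.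

Lemma submoduleZ U (N : set U) : submodule N -> forall a u, N u -> N (a *: u).
Proof. by case/submoduleP => N0 h a u Nu; rewrite -[X in N X]addr0; exact: h. Qed.

Lemma submoduleN U (N : set U) : submodule N -> forall u, N u -> N (- u).
Proof. by move=> hN u Nu; rewrite -scaleN1r; exact: submoduleZ. Qed.

Lemma submoduleB U (N : set U) : submodule N ->
  forall u v, N u -> N v -> N (u - v).
Proof. by move=> hN u v Nu Nv; apply: submoduleD => //; exact: submoduleN. Qed.

Lemma span_submodule U (S : set U) : submodule (submodule_span S).
Proof.
apply/submoduleP; split=> [N [hN _]|a u v Su Sv N [hN SN]].
  exact: submodule0.
apply: submoduleD => //; last by apply: Sv.
by apply: submoduleZ => //; apply: Su.
Qed.

Lemma subset_span U (S : set U) : S `<=` submodule_span S.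
Proof. exact: sub_gen_smallest. Qed.

Lemma span_min U (S N : set U) :
  submodule N -> S `<=` N -> submodule_span S `<=` N.
Proof. exact: smallest_sub. Qed.

Lemma cyclic_span_submodule U (x : U) : submodule (cyclic_span x).
Proof.
apply/submoduleP; split=> [|a _ _ [r _ <-] [s _ <-]].
  by exists 0; rewrite ?scale0r.
by exists (a * r + s); rewrite // scalerDl scalerA.
Qed.

Lemma cyclic_spanP U (x y : U) : cyclic_span x y <-> exists r, y = r *: x.
Proof. by split=> [[r _ <-]|[r ->]]; [exists r|exists r]. Qed.

Lemma cyclic_span_id U (x : U) : cyclic_span x x.
Proof. by exists 1; rewrite ?scale1r. Qed.

Lemma cyclic_span_min U (N : set U) x : submodule N -> N x -> cyclic_span x `<=` N.
Proof. by move=> hN Nx _ [r _ <-]; exact: submoduleZ. Qed.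

Lemma span1 U (x : U) : submodule_span [set x] = cyclic_span x.
Proof.
apply/seteqP; split.
  apply: span_min => [|_ ->]; first exact: cyclic_span_submodule.
  exact: cyclic_span_id.
by apply: cyclic_span_min => //; [exact: span_submodule|exact: subset_span].
Qed.

Lemma cyclic_finitely_generated U (x : U) : finitely_generated (cyclic_span x).
Proof. by exists [set x]; rewrite ?span1//; exact: finite_set1. Qed.

End LinearMaps.

(** * Quotient modules *)

Section Quotient.
Local Open Scope quotient_scope.
Variables (R : comNzRingType) (M : lmodType R) (N : set M).
Hypothesis hN : submodule N.

Let rel0 (x y : M) : bool := `[< N (x - y) >].
Let rel0_refl : reflexive rel0.
Proof. by move=> x; apply/asboolP; rewrite subrr; exact: submodule0. Qed.
Let rel0_sym : symmetric rel0.
Proof.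
by move=> x y; apply/asboolP/asboolP => /(submoduleN hN); rewrite opprB.
Qed.
Let rel0_trans : transitive rel0.
Proof.
move=> y x z /asboolP xy /asboolP yz; apply/asboolP.
by rewrite -(subrK y x) -addrA; exact: submoduleD.
Qed.
Let eqv := EquivRel rel0 rel0_refl rel0_sym rel0_trans.

Definition quotient : Type := {eq_quot eqv}.
HB.instance Definition _ := Choice.on quotient.

Let pi (x : M) : quotient := \pi_({eq_quot eqv}) x.
Let rp (x : quotient) : M := repr (x : {eq_quot eqv}).
Let rpK x : pi (rp x) = x. Proof. exact: reprK. Qed.
Let piE x y : pi x = pi y <-> N (x - y).
Proof. by split=> [/eqquotP/asboolP//|h]; apply/eqquotP/asboolP. Qed.

Let zero := pi 0.
Let add x y := pi (rp x + rp y).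
Let opp x := pi (- rp x).
Let scale (a : R) x := pi (a *: rp x).

Let piD x y : add (pi x) (pi y) = pi (x + y).
Proof.
apply/piE; rewrite opprD addrACA.
by apply: submoduleD => //; apply/piE; rewrite rpK.
Qed.
Let piN x : opp (pi x) = pi (- x).
Proof.
by apply/piE; rewrite -opprD; apply: submoduleN => //; apply/piE; rewrite rpK.
Qed.
Let piZ a x : scale a (pi x) = pi (a *: x).
Proof.
by apply/piE; rewrite -scalerBr; apply: submoduleZ => //; apply/piE; rewrite rpK.
Qed.

Let addA : associative add.
Proof. by move=> x y z; rewrite -(rpK x) -(rpK y) -(rpK z) !piD addrA. Qed.
Let addC : commutative add.
Proof. by move=> x y; rewrite -(rpK x) -(rpK y) !piD addrC. Qed.
Let add0 : left_id zero add.
Proof. by move=> x; rewrite -(rpK x) piD add0r. Qed.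
Let addN : left_inverse zero opp add.
Proof. by move=> x; rewrite -(rpK x) piN piD addNr. Qed.
HB.instance Definition _ := GRing.isZmodule.Build quotient addA addC add0 addN.

Let scaleA a b x : scale a (scale b x) = scale (a * b) x.
Proof. by rewrite -(rpK x) !piZ scalerA. Qed.
Let scale1 : left_id 1 scale.
Proof. by move=> x; rewrite -(rpK x) !piZ scale1r. Qed.
Let scaleDr : right_distributive scale +%R.
Proof.
move=> a x y; rewrite -(rpK x) -(rpK y).
by rewrite -[_ + _ in LHS]/(add _ _) -[RHS]/(add _ _) !(piD, piZ) scalerDr.
Qed.
Let scaleDl x : {morph scale^~ x : a b / a + b}.
Proof.
by move=> a b; rewrite -(rpK x) -[RHS]/(add _ _) !(piD, piZ) scalerDl.
Qed.
HB.instance Definition _ :=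
  GRing.Zmodule_isLmodule.Build R quotient scaleA scale1 scaleDr scaleDl.

Lemma quotient_exists : exists (Q : lmodType R) (q : {linear M -> Q}),
  (forall y, exists x, q x = y) /\ (forall x, q x = 0 <-> N x).
Proof.
have lpi : linear (pi : M -> quotient).
  by move=> a x y; rewrite -piD -piZ.
have [q qE] := linear_exists lpi.
exists quotient, q; split=> [y|x]; first by exists (rp y); rewrite qE rpK.
by rewrite qE -[0]/(pi 0) piE subr0.
Qed.

End Quotient.

Lemma quotient_lift (R : comNzRingType) (M Q W : lmodType R)
    (q : {linear M -> Q}) (g : {linear M -> W}) :
    (forall y, exists x, q x = y) -> (forall x, q x = 0 -> g x = 0) ->
  exists h : {linear Q -> W}, forall x, h (q x) = g x.
Proof.
move=> /choice[s sK] gq.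
have E x y : q x = q y -> g x = g y.
  move=> /eqP; rewrite -subr_eq0 -linearB => /eqP/gq; rewrite linearB => /eqP.
  by rewrite subr_eq0 => /eqP.
have lh : linear (g \o s).
  by move=> a x y /=; rewrite -linearP; apply: E; rewrite linearP !sK.
by have [h hE] := linear_exists lh; exists h => x; rewrite hE /=; apply: E.
Qed.

(** * Free modules and expansions in a spanning set *)

Section FreeModules.
Variable R : comNzRingType.

Lemma free_regular : free_module R^o.
Proof.
exists [set 1]; split=> [s c us sB|]; last first.
  by rewrite span1; apply/seteqP; split=> // r _; exists r; rewrite // [LHS]mulr1.
have {us sB} : s = [::] \/ s = [:: 1].
  case: s us sB => [|x [|y s]] /=; first by left.
    by move=> _ /(_ x (mem_head _ _)) ->; right.
  move=> /andP[+ _] sB; rewrite inE negb_or => /andP[/eqP xy _].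
  have x1 : x = 1 := sB x (mem_head _ _).
  have y1 : y = 1 by apply: sB; rewrite /= !inE eqxx orbT.
  by case: xy; rewrite x1 y1.
case=> -> // + v; rewrite big_seq1 mem_seq1 => c1 /eqP ->.
by rewrite -c1 [RHS]mulr1.
Qed.

Lemma basis_expansion (M : lmodType R) (B : set M) :
    submodule_span B = [set: M] ->
  forall x, exists (s : seq M) (c : M -> R),
    [/\ uniq s, [set` s] `<=` B & x = \sum_(v <- s) c v *: v].
Proof.
move=> spanB.
pose N := [set x | exists (s : seq M) (c : M -> R),
    [/\ uniq s, [set` s] `<=` B & x = \sum_(v <- s) c v *: v]].
have hN : submodule N.
  apply/submoduleP; split; first by exists [::], (fun=> 0); rewrite big_nil.
  move=> a _ _ [s [c [us sB ->]]] [t [d [ut tB ->]]].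
  (* Extending coefficients by 0 puts two expansions on one duplicate-free list, where they can be
     added. *)
  have ext (r : seq M) e : uniq r -> {subset r <= s ++ t} ->
      \sum_(v <- r) e v *: v =
      \sum_(v <- undup (s ++ t)) (if v \in r then e v else 0) *: v.
    move=> ur rst.
    rewrite [RHS](bigID (mem r))/= [X in _ + X]big1 ?addr0; last first.
      by move=> v /negPf ->; rewrite scale0r.
    under [RHS]eq_bigr => v vr do rewrite vr.
    rewrite -[RHS]big_filter.
    apply/perm_big/uniq_perm => //; first exact/filter_uniq/undup_uniq.
    move=> v; rewrite mem_filter mem_undup.
    by case vr : (v \in r) => //=; rewrite rst.
  exists (undup (s ++ t)), (fun v => a * (if v \in s then c v else 0) +
                               (if v \in t then d v else 0)).
  split; first exact: undup_uniq.
    by move=> v /=; rewrite mem_undup mem_cat => /orP[/sB|/tB].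
  rewrite (ext s c)// ?(ext t d)//; first last.
  - by move=> v vs; rewrite mem_cat vs.
  - by move=> v vs; rewrite mem_cat vs orbT.
  rewrite scaler_sumr -big_split; apply: eq_bigr => v _ /=.
  by rewrite scalerA scalerDl.
move=> x; have : submodule_span B x by rewrite spanB.
apply: (@span_min _ _ B N) => // v Bv.
exists [:: v], (fun=> 1); split=> // [w|]; last by rewrite big_seq1 scale1r.
by rewrite /= mem_seq1 => /eqP ->.
Qed.

End FreeModules.

(** * Elementwise criteria over a valuation ring *)

Section ValuationRing.
Variable R : comNzRingType.
Hypothesis hR : valuation_ring R.
Implicit Types M : lmodType R.

Lemma multiplesP (a b : R) :
  cyclic_span (b : R^o) a <-> exists r, a = r * b.
Proof. exact: cyclic_spanP. Qed.

Lemma divides_total (a b : R) : (exists r, a = r * b) \/ (exists r, b = r * a).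
Proof.
have [h|h] := hR (cyclic_span_submodule (a : R^o)) (cyclic_span_submodule (b : R^o)).
- by left; have /cyclic_spanP := h _ (cyclic_span_id (a : R^o)).
- by right; have /cyclic_spanP := h _ (cyclic_span_id (b : R^o)).
Qed.

(** Of two coefficients one divides the other, so a sum of two products is again a single
    product. *)
Lemma ideal_products_submodule M (A : set R^o) : ideal A ->
  submodule [set x : M | exists2 a, A a & exists m, x = (a : R) *: m].
Proof.
move=> hA; apply/submoduleP; split.
  by exists 0; [exact: submodule0|exists 0; rewrite scaler0].
move=> a _ _ [b Ab [m ->]] [c Ac [n ->]].
have [[r ->]|[r ->]] := divides_total b c.
- exists c => //; exists ((a * r) *: m + n).
  by rewrite scalerDr !scalerA mulrA [c * _]mulrC.
- exists b => //; exists (a *: m + r *: n).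
  by rewrite scalerDr !scalerA [a * b]mulrC [r * b]mulrC.
Qed.

Lemma ideal_scaleP M (A : set R^o) (x : M) : ideal A ->
  ideal_scale A x <-> exists2 a, A a & exists m, x = (a : R) *: m.
Proof.
move=> hA; split=> [|[a Aa [m ->]]]; last first.
  by rewrite /ideal_scale; apply: subset_span; exists a => //; exists m.
apply: (@span_min _ _ _ [set x : M | exists2 a, A a & exists m, x = (a : R) *: m]).
  exact: ideal_products_submodule.
by move=> _ [a Aa [m _ <-]]; exists a => //; exists m.
Qed.

(** Some coefficient divides all the others. Taking it as [d] (0 for the empty sum) makes whatever
    kills all coefficients kill [d]. *)
Lemma sum_factor M (I : eqType) (s : seq I) (c : I -> R) (m : I -> M) :
  exists d n, \sum_(i <- s) c i *: m i = d *: n /\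
    forall r, (forall i, i \in s -> r * c i = 0) -> r * d = 0.
Proof.
elim: s => [|i s [d [n [E h]]]].
  by exists 0, 0; rewrite big_nil scaler0; split=> // r _; rewrite mulr0.
have [[r ciE]|[r dE]] := divides_total (c i) d.
  exists d, (r *: m i + n); rewrite big_cons E ciE scalerDr scalerA [d * r]mulrC.
  by split=> // t ht; apply: h => j js; apply: ht; rewrite inE js orbT.
exists (c i), (m i + r *: n); rewrite big_cons E dE scalerDr scalerA [c i * r]mulrC.
by split=> // t ht; apply: ht; rewrite inE eqxx.
Qed.

(** Left to right: expand the image of x over a basis and factor the sum; by independence, whatever
    kills x kills every coefficient. Right to left: Rx maps to M through R, with x going to a and 1
    to m. *)
Lemma singly_projectiveP M : singly_projective M <->
  forall x : M, exists a m, x = a *: m /\ forall r, r *: x = 0 -> r * a = 0.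
Proof.
split=> [spM x|spM N hN [x NE]].
  have hN := cyclic_span_submodule x.
  have [|F [f [g [[B [Bfree Bspan]] gf]]]] := spM _ hN; first by exists x.
  have xN : x \in cyclic_span x by apply: mem_set; exact: cyclic_span_id.
  pose y : submod hN := Submod hN xN.
  have [s [c [us sB fE]]] := basis_expansion Bspan (f y).
  have [d [n [sumE hd]]] := sum_factor s c (fun v => g v).
  exists d, n; split=> [|r rx].
    rewrite -sumE -[x]/(val y) -gf fE linear_sum.
    by apply: eq_bigr => v _; rewrite linearZ.
  apply: hd => v vs; apply: (Bfree s (fun v => r * c v)) vs => //.
  under eq_bigr do rewrite -scalerA.
  rewrite -scaler_sumr -fE -linearZ.
  suff -> : r *: y = 0 by rewrite linear0.
  by apply: val_inj; rewrite linearZ.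
have [a [m [xE h]]] := spM x.
have rep (y : submod hN) : exists r, val y = r *: x.
  by apply/cyclic_spanP; rewrite -NE; apply: set_mem; exact: submod_valP.
have [c cE] := choice rep.
(* Two coefficients of the same element differ by an annihilator of x, hence of a; so the arbitrary
   choice [c] still gives a linear map. *)
have lf : linear (fun y => c y * a : R^o).
  move=> r y z; apply/eqP; rewrite -subr_eq0; apply/eqP.
  rewrite [r *: (_ * _)]mulrA -mulrDl -mulrBl; apply: h.
  by rewrite scalerBl scalerDl -scalerA -!cE linearP subrr.
have lg : linear (fun r : R^o => r *: m).
  by move=> r y z; rewrite scalerDl scalerA.
have [f fE] := linear_exists lf; have [g gE] := linear_exists lg.
exists R^o, f, g; split=> [|y]; first exact: free_regular.
by rewrite gE fE -scalerA -xE cE.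
Qed.

(** Every element of AM is a product, so principal ideals suffice to test the content, and [a]
    generates it. *)
Lemma content_moduleP M : content_module M <->
  forall x : M, exists a m, x = a *: m /\
    forall b n, x = b *: n -> exists r, a = r * b.
Proof.
have hc (x : M) : ideal (content x).
  apply/submoduleP; split=> [A [hA _]|a u v cu cv A [hA xA]].
    exact: submodule0.
  by apply: submoduleD => //; [apply: submoduleZ => //; apply: cu|apply: cv].
split=> cM x.
  have /ideal_scaleP[//|a ca [m xE]] := cM x.
  exists a, m; split=> // b n xbn; apply/multiplesP.
  apply: ca; split; first exact: (cyclic_span_submodule (b : R^o)).
  apply/ideal_scaleP; first exact: (cyclic_span_submodule (b : R^o)).
  by exists b; [exact: (cyclic_span_id (b : R^o))|exists n].
have [a [m [xE h]]] := cM x.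
apply/ideal_scaleP => //; exists a; last by exists m.
move=> A [hA /ideal_scaleP[//|b Ab [n /h[r ->]]]].
exact: (submoduleZ hA r Ab).
Qed.

End ValuationRing.

(** * Flatness by elements *)

Section Flatness.
Variable R : comNzRingType.
Hypothesis hR : valuation_ring R.
Implicit Types A B M W : lmodType R.

(** This says that the r-torsion of M is (0 : r) M, which is flatness tested on the inclusion of Rr
    in R. *)
Definition torsion_divisible M : Prop :=
  forall (r : R) (x : M), r *: x = 0 -> exists c m, r * c = 0 /\ x = c *: m.

Lemma linear_injective A B (f : {linear A -> B}) :
  (forall x, f x = 0 -> x = 0) -> injective f.
Proof.
move=> f0 x y /eqP; rewrite -subr_eq0 -linearB => /eqP/f0/eqP.
by rewrite subr_eq0 => /eqP.
Qed.

Lemma regular_tensor M : exists t : {bilinear R^o -> M -> M},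
  (forall a m, t a m = (a : R) *: m) /\ is_tensor_product t.
Proof.
have [||t tE] := @bilinear_exists R R^o M M (fun a m => (a : R) *: m).
- by move=> m a x y; rewrite scalerDl scalerA.
- by move=> r a x y; rewrite scalerDr !scalerA mulrC.
exists t; split=> // W b.
have lb : linear (b 1) by move=> a x y; rewrite linearPr.
have [h hE] := linear_exists lb.
exists h; split=> [a m|h' h'E m]; last by rewrite hE -(h'E 1 m) tE scale1r.
rewrite hE tE linearZr_LR -linearZl_LR; congr (b _ m); exact: mulr1.
Qed.

(** Tensored with M, the inclusion of Rr in R sends the tensor of r and x to rx = 0, so this tensor
    is 0. The bilinear map taking (cr, m) to cm modulo (0 : r) M sends it to the class of x. *)
Lemma flat_torsion_divisible M : flat M -> torsion_divisible M.
Proof.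
move=> fM r x rx.
have hA := cyclic_span_submodule (r : R^o).
have lval : linear (fun y : submod hA => val y) by move=> a y z; rewrite linearP.
have [f fE] := linear_exists lval.
have finj : injective f by move=> y z; rewrite !fE; exact: val_inj.
have [t [tE tP]] := regular_tensor M.
have [TA [tA tAP]] := tensor_product_exists (submod hA) M.
have [||b bE] := @bilinear_exists R (submod hA) M M (fun a m => (val a : R) *: m).
- by move=> m a y z; rewrite linearP scalerDl scalerA.
- by move=> y a m n; rewrite scalerDr !scalerA mulrC.
have [h [hE _]] := tAP _ b.
have hinj := fM _ _ f finj _ _ tA t tAP tP h.
have rA : (r : R^o) \in cyclic_span (r : R^o).
  by apply: mem_set; exact: (cyclic_span_id (r : R^o)).
have tA0 : tA (Submod hA rA) x = 0.
  apply: hinj; first by move=> a m; rewrite hE bE tE fE.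
  by rewrite hE bE linear0.
pose K := [set x : M | exists2 c, [set c : R^o | r * c = 0] c &
                         exists m, x = (c : R) *: m].
have hK : submodule K.
  apply: (ideal_products_submodule hR); apply/submoduleP; split.
    exact: mulr0.
  move=> a u v /= ru rv; rewrite mulrDr rv addr0.
  by rewrite [a *: u]/(a * u) mulrCA ru mulr0.
have [Q [q [_ qK]]] := quotient_exists hK.
have /choice[c cE] (y : submod hA) : exists c : R, val y = c * r.
  by apply/(multiplesP (val y) r)/set_mem; exact: submod_valP.
have wd (a d : R) m : a * r = d * r -> q (a *: m) = q (d *: m).
  move=> ad; apply/eqP; rewrite -subr_eq0 -linearB -scalerBl; apply/eqP/qK.
  by exists (a - d); [rewrite /= mulrC mulrBl ad subrr|exists m].
have [||b' b'E] := @bilinear_exists R (submod hA) M Q (fun y m => q (c y *: m)).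
- move=> m a y z; rewrite -linearP scalerA -scalerDl; apply: wd.
  by rewrite mulrDl -mulrA -!cE [LHS]linearP.
- by move=> y a m n; rewrite -linearP scalerDr !scalerA mulrC.
have [h' [h'E _]] := tAP _ b'.
have : q x = 0.
  rewrite -[x]scale1r (wd 1 (c (Submod hA rA))); last by rewrite mul1r -cE.
  by rewrite -b'E -h'E tA0 linear0.
by move=> /qK[d /= rd [m ->]]; exists d, m.
Qed.

(** [b] is total but constrained only on [N], so that the domain can grow without a change of
    type. *)
Definition bilinear_on B M W (N : set B) (b : B -> M -> W) : Prop :=
  (forall r x y m, N x -> N y -> b (r *: x + y) m = r *: b x m + b y m) /\
  (forall x, N x -> linear (b x)).

Definition adjoin B (N : set B) (e : B) : set B :=
  [set x | exists n r, N n /\ x = n + r *: e].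

Lemma adjoin_submodule B (N : set B) e : submodule N -> submodule (adjoin N e).
Proof.
move=> hN; apply/submoduleP; split.
  by exists 0, 0; rewrite scale0r addr0; split=> //; exact: submodule0.
move=> a _ _ [n [r [Nn ->]]] [n' [r' [Nn' ->]]].
exists (a *: n + n'), (a * r + r'); split.
  by apply: (submoduleD hN) => //; exact: (submoduleZ hN).
by rewrite scalerDr scalerDl scalerA addrACA.
Qed.

(* The target is [(W * M) / K], where [K] identifies [b (i e) n] with [i n]
   whenever [i e] lies in [N]; flatness of [M] makes [W] embed in it. *)
Lemma bilinear_on_adjoin B M W (N : set B) (b : B -> M -> W) (e : B) :
    torsion_divisible M -> submodule N -> bilinear_on N b ->
  exists (W' : lmodType R) (i : {linear W -> W'}) (b' : B -> M -> W'),
    [/\ injective i, bilinear_on (adjoin N e) b' &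
        forall x m, N x -> b' x m = i (b x m)].
Proof.
move=> dM hN [bl br]; have N0 := submodule0 hN.
have b0 m : b 0 m = 0.
  by have := bl (-1) 0 0 m N0 N0; rewrite scaler0 addr0 scaleN1r addNr.
have bZ r x m : N x -> b (r *: x) m = r *: b x m.
  by move=> Nx; rewrite -[r *: x]addr0 bl// b0 addr0.
have bD x y m : N x -> N y -> b (x + y) m = b x m + b y m.
  by move=> Nx Ny; rewrite -[x]scale1r bl// !scale1r.
have b0r x : N x -> b x 0 = 0.
  by move=> Nx; have := br x Nx (-1) 0 0; rewrite scaler0 addr0 scaleN1r addNr.
have bZr r x m : N x -> b x (r *: m) = r *: b x m.
  by move=> Nx; rewrite -[r *: m]addr0 br// b0r// addr0.
have bDr x m n : N x -> b x (m + n) = b x m + b x n.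
  by move=> Nx; rewrite -[m]scale1r br// !scale1r.
pose K := [set u : (W * M)%type |
  exists i n, [/\ N (i *: e), u.1 = b (i *: e) n & u.2 = - (i *: n)]].
have hK : submodule K.
  apply/submoduleP; split.
    by exists 0, 0; rewrite !scale0r b0 oppr0.
  move=> a [_ _] [_ _] [i [n [/= Ni -> ->]]] [j [m [/= Nj -> ->]]].
  have [[r E]|[r E]] := divides_total hR i j.
  - exists j, ((a * r) *: n + m); split=> //=.
      by rewrite br// -scalerA E -[(r * j) *: e]scalerA (bZ r). 
    by rewrite E scalerDr opprD !scalerN !scalerA [j * _]mulrC mulrA.
  - exists i, (a *: n + r *: m); split=> //=.
      by rewrite br// E -scalerA (bZ r)// (bZr r).
    by rewrite E scalerDr opprD !scalerN !scalerA ![i * _]mulrC.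
have [Q [q [_ qK]]] := quotient_exists hK.
have li : linear (fun w : W => q (w, 0)).
  move=> a x y; rewrite -linearP; congr (q _).
  by rewrite /= -[RHS]/(_, _) /= scaler0 addr0.
have [i iE] := linear_exists li.
have wd x r x' r' m : N x -> N x' -> x + r *: e = x' + r' *: e ->
    q (b x m, r *: m) = q (b x' m, r' *: m).
  move=> Nx Nx' E; apply/eqP; rewrite -subr_eq0 -linearB; apply/eqP/qK.
  have E' : (r - r') *: e = x' - x.
    rewrite scalerBl; apply/eqP.
    by rewrite subr_eq addrAC -E addrAC subrr add0r.
  exists (r - r'), (- m); rewrite E' /=; split.
  - exact: (submoduleB hN).
  - rewrite -[- m]scaleN1r bZr; last exact: (submoduleB hN).
    rewrite bD//; last exact: (submoduleN hN).
    by rewrite -[- x]scaleN1r bZ// !scaleN1r opprB.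
  - by rewrite scalerN opprK scalerBl.
have /choice[s sP] x : exists p : B * R,
    adjoin N e x -> N p.1 /\ x = p.1 + p.2 *: e.
  have [[n [r [Nn ->]]]|nx] := pselect (adjoin N e x); last by exists (0, 0).
  by exists (n, r).
pose b' x m := q (b (s x).1 m, (s x).2 *: m).
have b'E x r m : N x -> b' (x + r *: e) m = q (b x m, r *: m).
  move=> Nx; have [|Ns E] := sP (x + r *: e); first by exists x, r.
  by apply: wd => //; rewrite -E.
exists Q, i, b'; split.
(* If (w, 0) is in [K], then w = b (j e) n with j n = 0; writing n = c y with j c = 0 gives w = b (c
   j e) y = 0. *)
- apply: linear_injective => w; rewrite iE => /qK[j [n [/= Nj -> /eqP]]].
  rewrite eq_sym oppr_eq0 => /eqP /dM[c [y [jc ->]]].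
  by rewrite bZr// -bZ// scalerA mulrC jc scale0r b0.
- split=> [a _ _ m [x [r [Nx ->]]] [y [t [Ny ->]]]|_ [x [r [Nx ->]]] a m n].
    rewrite scalerDr addrACA scalerA -scalerDl !b'E//; last first.
      by apply: (submoduleD hN) => //; exact: (submoduleZ hN).
    rewrite -linearP; congr (q _).
    by rewrite bl// scalerDl -scalerA.
  rewrite !b'E// -linearP; congr (q _).
  by rewrite br// -[RHS]/(_, _) /= scalerDr !scalerA [a * r]mulrC.
- by move=> x m Nx; rewrite -[x]addr0 -(scale0r e) b'E// scale0r iE scale0r addr0.
Qed.

(** The universal map from A x M to [TA] is extended to B x M, with values in some [Q]: for each
    finite list its elements are adjoined to the range of [f] one by one, and the results are glued.
    The induced [g] on [TB] satisfies g (h x) = j x, where [j] is injective. *)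
Lemma torsion_divisible_flat M : torsion_divisible M -> flat M.
Proof.
move=> dM A B f finj TA TB tA tB tAP tBP h hE.
pose N : seq B -> set B := foldr (fun e N => adjoin N e) (range f).
have hN l : submodule (N l).
  elim: l => [|e l IH]; last exact: adjoin_submodule.
  apply/submoduleP; split; first by exists 0; rewrite ?linear0.
  by move=> a _ _ [x _ <-] [y _ <-]; exists (a *: x + y); rewrite ?linearP.
have Nmem l e : e \in l -> N l e.
  elim: l => // e' l IH; rewrite inE => /orP[/eqP <-|/IH Ne].
    by exists 0, 1; rewrite scale1r add0r; split=> //; exact: submodule0.
  by exists e, 0; rewrite scale0r addr0.
pose extension l (W : lmodType R) (i : {linear TA -> W}) (b : B -> M -> W) :=
  [/\ injective i, bilinear_on (N l) b & forall a m, b (f a) m = i (tA a m)].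
have ext l : exists W : lmodType R, exists ib : {linear TA -> W} * (B -> M -> W),
    extension l W ib.1 ib.2.
  elim: l => [|e l [W [[i b] /= [iinj bb bE]]]].
    (* On the range of [f], [g] gives the preimage, unique by injectivity; elsewhere its value is a
       dummy 0. *)
    have /choice[g gE] x : exists a, N [::] x -> x = f a.
      have [[a _ <-]|nx] := pselect (N [::] x); first by exists a.
      by exists 0.
    have gK a : g (f a) = a by apply/esym/finj/gE; exists a.
    have lid : linear (@id TA) by [].
    have [i iE] := linear_exists lid.
    exists TA, (i, fun x m => tA (g x) m); split=> /=.
    - by move=> x y; rewrite !iE.
    - split=> [r _ _ m [x _ <-] [y _ <-]|_ [x _ <-] r m n].
        by rewrite -linearP !gK linearPl.
      by rewrite linearPr.
    - by move=> a m; rewrite gK iE.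
  have [W' [j [b' [jinj bb' b'E]]]] := bilinear_on_adjoin e dM (hN l) bb.
  have lji : linear (j \o i) by move=> a x y /=; rewrite !linearP.
  have [k kE] := linear_exists lji.
  exists W', (k, b'); split=> //= [x y|a m]; first by rewrite !kE => /jinj/iinj.
  rewrite kE b'E ?bE//.
  have Nf l' : N l' (f a).
    elim: l' => [|e' l' IH]; first by exists a.
    by exists (f a), 0; rewrite scale0r addr0.
  exact: Nf.
have /choice[W hW] := ext.
pose ib l := sval (cid (hW l)).
have ibP l : extension l (W l) (ib l).1 (ib l).2 := svalP (cid (hW l)).
(* The extensions to finitely generated overmodules need not be compatible, but
   they glue modulo families vanishing on all large enough lists. *)
pose K := [set x : prod_module W |
  exists l0 : seq B, forall l : seq B, {subset l0 <= l} -> x l = 0].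
have hK : submodule K.
  apply/submoduleP; split; first by exists [::].
  move=> a u v [l0 u0] [l1 v0]; exists (l0 ++ l1) => l sl.
  rewrite -[LHS]/(a *: u l + v l) u0 ?v0 ?scaler0 ?addr0// => x xl;
  by apply: sl; rewrite mem_cat xl ?orbT.
have [Q [q [_ qK]]] := quotient_exists hK.
have qE (u v : prod_module W) (l0 : seq B) :
    (forall l : seq B, {subset l0 <= l} -> u l = v l) -> q u = q v.
  move=> uv; apply/eqP; rewrite -subr_eq0 -linearB; apply/eqP/qK.
  by exists l0 => l /uv E; rewrite -[LHS]/(u l - v l) E subrr.
pose b x m : prod_module W := fun l => (ib l).2 x m.
have [||c cE] := @bilinear_exists R B M Q (fun x m => q (b x m)).
- move=> m a x y; rewrite -linearP; apply: (qE _ _ [:: x; y]) => l sl.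
  have [_ [bl _] _] := ibP l; apply: bl; apply: Nmem; apply: sl;
  by rewrite !inE eqxx ?orbT.
- move=> x a m n; rewrite -linearP; apply: (qE _ _ [:: x]) => l sl.
  have [_ [_ br] _] := ibP l; apply: br; apply: Nmem; apply: sl.
  by rewrite inE.
have [g [gE _]] := tBP _ c.
have lj : linear (fun x => q ((fun l => (ib l).1 x) : prod_module W)).
  move=> a x y; rewrite -linearP; apply: (qE _ _ [::]) => l _.
  exact: linearP.
have [j jE] := linear_exists lj.
have ljb : linear (g \o h) by move=> a x y /=; rewrite !linearP.
have [gh ghE] := linear_exists ljb.
have [||jb jbE] := @bilinear_exists R A M Q (fun a m => j (tA a m)).
- by move=> m a x y; rewrite linearPl linearP.
- by move=> x a m n; rewrite linearPr linearP.
have [k [_ kuniq]] := tAP _ jb.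
have gj x : g (h x) = j x.
  rewrite -[LHS]/((g \o h) x) -ghE (kuniq gh) ?(kuniq j)// => a m.
  rewrite ghE /= hE gE cE jbE jE; apply: (qE _ _ [::]) => l _.
  by have [_ _] := ibP l; apply.
apply: linear_injective => x hx.
have : j x = 0 by rewrite -gj hx linear0.
(* A family that is 0 in [Q] vanishes at all lists containing some [l0], hence at [l0] itself, where
   the map is injective. *)
rewrite jE => /qK[l0 /(_ l0 (fun _ => id)) /= ix].
have [iinj _ _] := ibP l0; apply: iinj.
by rewrite ix linear0.
Qed.

End Flatness.

(** * Ideals, annihilators and multiples of the maximal ideal *)

Section Ideals.
Variables (R : comNzRingType) (P : set R^o).
Hypotheses (hR : valuation_ring R) (hP : maximal_ideal P).
Implicit Types A : set R^o.

Lemma annihilator_ideal A : ideal (annihilator A).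
Proof.
apply/submoduleP; split=> [a _|a u v hu hv b Ab]; first by rewrite mul0r.
by rewrite [a *: u]/(a * u) mulrDl -mulrA hu// hv// mulr0 addr0.
Qed.

Lemma annihilator_principal (a : R) :
  annihilator (cyclic_span (a : R^o)) = [set r : R^o | r * a = 0].
Proof.
apply/seteqP; split=> [r h|r ra _ [s _ <-]] /=.
  by apply: h; exact: (cyclic_span_id (a : R^o)).
by rewrite [s *: _]/(s * a) mulrCA ra mulr0.
Qed.

Lemma unit_notin p : ~ P p -> exists r, r * p = 1.
Proof.
case: hP => iP PT Pmax nPp.
have [h|h] := hR (cyclic_span_submodule (p : R^o)) iP.
  by case: nPp; apply: h; exact: cyclic_span_id.
have [E|E] := Pmax _ (cyclic_span_submodule (p : R^o)) h.
  by case: nPp; rewrite -E; exact: cyclic_span_id.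
have : cyclic_span p (1 : R^o) by rewrite E.
by move=> [r _ rp]; exists r.
Qed.

Lemma maximal_proper : ~ P 1.
Proof.
case: hP => iP PT _ P1; apply: PT; apply/seteqP; split=> // r _.
by rewrite -[r]mulr1; exact: submoduleZ.
Qed.

Lemma maximal_mull r p : P p -> P (r * p).
Proof. by case: hP => iP _ _ Pp; exact: (submoduleZ iP). Qed.

(** As P is proper, 1 - p lies outside it, so it is a unit, and it kills a. *)
Lemma nakayama p a : P p -> a = p * a -> a = 0.
Proof.
move=> Pp E; have [h|r ru] := @unit_notin (1 - p).
  apply: maximal_proper; rewrite -(subrK p 1).
  by case: hP => iP _ _; exact: submoduleD.
by rewrite -[a]mul1r -ru -mulrA mulrBl mul1r -E subrr mulr0.
Qed.

(** If b = ra with r outside P, then r is a unit and a is a multiple of b. *)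
Lemma divides_or a b : (exists r, a = r * b) \/ (exists2 p, P p & b = p * a).
Proof.
have [h|[r E]] := divides_total hR a b; first by left.
have [Pr|/unit_notin[s sr]] := pselect (P r); first by right; exists r.
by left; exists s; rewrite E mulrA sr mul1r.
Qed.

Lemma ideal_dichotomy A a : ideal A ->
  A a \/ forall x, A x -> exists2 p, P p & x = p * a.
Proof.
move=> iA; have [Aa|nAa] := pselect (A a); first by left.
right=> x Ax; have [[r E]|//] := divides_or a x.
by case: nAa; rewrite E; exact: (submoduleZ iA).
Qed.

Lemma span_finite_principal (S : set R^o) : finite_set S ->
  exists2 a, submodule_span S a & S `<=` cyclic_span a.
Proof.
move=> /finite_seqP[s ->]; elim: s => [|x s [a sa h]].
  by exists 0; [exact: (submodule0 (span_submodule _))|by move=> x].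
have sub : submodule_span [set` s] `<=` submodule_span [set` x :: s].
  apply: span_min => [|y ys]; first exact: span_submodule.
  by apply: subset_span; rewrite /= inE; apply/orP; right.
have [[r E]|[r E]] := divides_total hR x a.
  exists a; first exact: sub.
  move=> y; rewrite /= inE => /orP[/eqP ->|/h//].
  by apply/cyclic_spanP; exists r.
exists x; first by apply: subset_span; rewrite /= mem_head.
move=> y; rewrite /= inE => /orP[/eqP ->|/h/cyclic_spanP[t ->]].
  exact: cyclic_span_id.
by apply/cyclic_spanP; exists (t * r); rewrite E; exact: mulrA.
Qed.

Lemma finitely_generated_principal A : finitely_generated A <-> principal A.
Proof.
split=> [[S fS ->]|[a ->]]; last exact: cyclic_finitely_generated.
have [a sa h] := span_finite_principal fS; exists a; apply/seteqP; split.
  by apply: span_min => //; exact: cyclic_span_submodule.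
by apply: cyclic_span_min => //; exact: span_submodule.
Qed.

(* [tight A] says that a generating family of [A], as an element of a power of
   [R], satisfies the criterion of [singly_projectiveP]. *)
Definition tight A : Prop :=
  exists a : R, A `<=` cyclic_span (a : R^o) /\
    forall r : R, (forall b : R, A b -> r * b = 0) -> r * a = 0.

Definition ideals_translates : Prop := (principal P \/ faithful P) /\
  forall A, ideal A ->
    exists a : R, A = cyclic_span (a : R^o) \/ A = ideal_mulr P a.

Definition annihilators_principal : Prop :=
  forall A, ideal A -> principal (annihilator A).

(** For Ra take a. For Pa take pa if P = Rp; if P is faithful, rPa = 0 gives ra = 0 and a itself
    works. *)
Lemma translates_tight : ideals_translates -> forall A, ideal A -> tight A.
Proof.
move=> [hpf h5] A /h5[a [->|->]].
  exists a; split=> // r; apply; exact: (cyclic_span_id (a : R^o)).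
case: hpf => [[p PE]|fP].
  have Pp : P p by rewrite PE; exact: cyclic_span_id.
  exists (p * a); split=> [_ [q Pq <-]|r]; last by apply; exists p.
  move: Pq; rewrite PE => /cyclic_spanP[s ->]; apply/cyclic_spanP; exists s.
  exact: esym (mulrA _ _ _).
exists a; split=> [_ [q Pq <-]|r hr]; first by apply/cyclic_spanP; exists q.
have : annihilator P (r * a).
  by move=> q Pq; rewrite mulrAC -mulrA; apply: hr; exists q.
by rewrite fP.
Qed.

(** Tightness puts (0 : A) in some Ra, with a killed by all that kills (0 : A), hence by A; so a
    lies in (0 : A). *)
Lemma tight_annihilators :
  (forall A, ideal A -> tight A) -> annihilators_principal.
Proof.
move=> ht A iA; have [a [sub ha]] := ht _ (annihilator_ideal A).
exists a; apply/seteqP; split=> //.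
apply: (cyclic_span_min (annihilator_ideal A)) => b Ab.
by rewrite mulrC; apply: ha => c hc; rewrite mulrC hc.
Qed.

Hypothesis hZ : zero_divisors R <> [set 0].

Lemma zero_divisor_exists : exists z x : R, [/\ z <> 0, x <> 0 & z * x = 0].
Proof.
apply: contrapT => h; apply: hZ; apply/seteqP; split=> [z [x [x0 zx]]|_ ->].
  by apply: contrapT => z0; apply: h; exists z, x.
by exists 1; split; [apply/eqP/oner_neq0|rewrite mul0r].
Qed.

Definition maximal_zero_divisors : Prop :=
  forall p, P p -> exists2 x : R, x <> 0 & p * x = 0.

(** Let p in P be regular, zx = 0 with z and x nonzero, and (0 : x) = Rc. As px is nonzero, p is not
    in Rc, so c = rp. Regularity puts r in Rc, so c is in Pc and c = 0 by Nakayama, against z in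
    Rc. *)
Lemma annihilators_maximal_zero_divisors :
  annihilators_principal -> maximal_zero_divisors.
Proof.
move=> hA p Pp; apply: contrapT => np.
have reg x : p * x = 0 -> x = 0.
  by move=> px; apply: contrapT => x0; apply: np; exists x.
have [z [x [z0 x0 zx]]] := zero_divisor_exists.
have := hA _ (cyclic_span_submodule (x : R^o)).
rewrite annihilator_principal => -[c cE].
have cx : c * x = 0.
  by have : cyclic_span c c := cyclic_span_id c; rewrite -cE.
have [[r E]|[r Pr E]] := divides_or c p; last first.
  by apply/x0/reg; rewrite E -mulrA cx mulr0.
have : cyclic_span c (r : R^o).
  by rewrite -cE /=; apply: reg; rewrite mulrA [p * r]mulrC -E.
move=> /cyclic_spanP[s rE].
have c0 : c = 0.
  by apply: (nakayama (maximal_mull s Pp)); rewrite {1}E rE [s *: c]/(s * c) mulrAC.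
have : cyclic_span c (z : R^o) by rewrite -cE.
by move=> /cyclic_spanP[t]; rewrite c0 scaler0.
Qed.

(** Take x nonzero with px = 0. If x divides a, then pa = 0, so 1 kills pa and hence a. If x = ra,
    then r kills pa, hence a, and x = 0. *)
Lemma annihilator_mul_eq0 : maximal_zero_divisors ->
  forall p a, P p -> (forall r, r * (p * a) = 0 -> r * a = 0) -> a = 0.
Proof.
move=> hPZ p a Pp h; apply: contrapT => a0.
have [x x0 px] := hPZ p Pp.
have [[r E]|[r E]] := divides_total hR a x.
  by apply: a0; rewrite -[a]mul1r; apply: h; rewrite mul1r E mulrCA px mulr0.
by apply: x0; rewrite E; apply: h; rewrite mulrCA -E.
Qed.

Lemma annihilators_translates : annihilators_principal -> ideals_translates.
Proof.
move=> hA; have hPZ := annihilators_maximal_zero_divisors hA.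
have cancel := annihilator_mul_eq0 hPZ; case: (hP) => iP PT _.
(* As a is not in A, A lies in Pa. If A missed pa with p in P, it would lie in Ppa; whatever kills
   pa would kill A, hence a, forcing a = 0. *)
have PA A a : ideal A -> ~ A a ->
    (forall r, (forall b : R, A b -> r * b = 0) -> r * a = 0) ->
    a = 0 \/ A = ideal_mulr P a.
  move=> iA nAa h; have [//|AP] := @ideal_dichotomy A a iA.
  have [->|a0] := pselect (a = 0); [by left|right].
  apply/seteqP; split=> [x /AP[p Pp ->]|_ [p Pp <-]]; first by exists p.
  have [//|ApP] := @ideal_dichotomy A (p * a) iA.
  case: a0; apply: (cancel p a Pp) => r hr; apply: h => b /ApP[q _ ->].
  by rewrite mulrCA hr mulr0.
split.
  (* With (0 : P) = Rs, either s = 0 and P is faithful, or P = (0 : s), since elements outside P are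
     units. *)
  have [s sE] := hA _ iP.
  have [s0|s0] := pselect (s = 0); [right|left].
    by rewrite /faithful sE s0; apply/seteqP; split=> [_ [r _ <-]|_ ->];
      [exact: scaler0|exists 0; rewrite ?scaler0].
  suff -> : P = annihilator (cyclic_span s) by exact/hA/cyclic_span_submodule.
  rewrite annihilator_principal; apply/seteqP; split=> [p Pp|p ps] /=.
    have : annihilator P s by rewrite sE; exact: cyclic_span_id.
    by move=> /(_ p Pp); rewrite mulrC.
  apply: contrapT => /unit_notin[r rp]; apply: s0.
  by rewrite -[s]mul1r -rp -mulrA ps mulr0.
(* With (0 : A) = Rb and (0 : b) = Rc, A lies in Rc and whatever kills A kills c. *)
move=> A iA; have [b bE] := hA A iA.
have [c cE] := hA _ (cyclic_span_submodule b).
have cb : c * b = 0.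
  have : cyclic_span c c := cyclic_span_id c.
  by rewrite -cE annihilator_principal.
have Asub : A `<=` cyclic_span c.
  rewrite -cE annihilator_principal => x Ax /=.
  have : annihilator A b by rewrite bE; exact: cyclic_span_id.
  by move=> /(_ x Ax); rewrite mulrC.
exists c; have [Ac|nAc] := pselect (A c).
  by left; apply/seteqP; split=> //; exact: cyclic_span_min.
have [r hr|c0|->] := PA A c iA nAc; last by right.
  have : annihilator A r by [].
  rewrite bE => /cyclic_spanP[t ->].
  by rewrite [t *: b]/(t * b) -mulrA [b * c]mulrC cb mulr0.
by case: nAc; rewrite c0; exact: submodule0.
Qed.

(** Let Rd be the intersection of the principal ideals containing A, R being one. If A missed d and
    some pd with p in P, it would lie in Rpd; then d is in Rpd and is 0 by Nakayama. *)
Lemma intersections_translates :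
    (principal P \/ faithful P) ->
    (forall F : set (set R^o), F !=set0 -> (forall A, F A -> principal A) ->
      finitely_generated (\bigcap_(A in F) A)) ->
  ideals_translates.
Proof.
move=> hpf hF; split=> // A iA.
pose F := [set C : set R^o | principal C /\ A `<=` C].
have [|C []//|d dE] := (finitely_generated_principal _).1 (hF F _ _).
  exists (cyclic_span 1); split=> [|x _]; first by exists 1.
  by exists x; rewrite // [LHS]mulr1.
have Asub : A `<=` cyclic_span d by rewrite -dE => x Ax C [_]; apply.
have dmin b : A `<=` cyclic_span b -> exists r, d = r * b.
  move=> Ab; apply/cyclic_spanP; have : cyclic_span d d := cyclic_span_id d.
  by rewrite -dE; apply; split=> //; exists b.
exists d; have [//|AP] := @ideal_dichotomy A d iA.
  by left; apply/seteqP; split=> //; exact: cyclic_span_min.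
have [d0|d0] := pselect (d = 0).
  left; apply/seteqP; split=> // x /cyclic_spanP[r ->].
  by rewrite d0 scaler0; exact: submodule0.
right; apply/seteqP; split=> [x /AP[p Pp ->]|_ [p Pp <-]]; first by exists p.
have [//|ApP] := @ideal_dichotomy A (p * d) iA.
have [x /ApP[q _ ->]|r E] := dmin (p * d); first by apply/cyclic_spanP; exists q.
by case: d0; apply: (nakayama (maximal_mull r Pp)); rewrite -mulrA.
Qed.

(** Each Ra is the annihilator of (0 : a), so an intersection of such ideals is the annihilator of
    the sum of the (0 : a). *)
Lemma annihilators_intersections : annihilators_principal ->
  forall F : set (set R^o), (forall A, F A -> principal A) ->
  finitely_generated (\bigcap_(A in F) A).
Proof.
move=> hA F Fp; have hPZ := annihilators_maximal_zero_divisors hA.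
(* If a does not divide b, then a = pb with p in P, and (0 : pb) inside (0 : b) forces b = 0. *)
have dual (a b : R) : (forall r, r * a = 0 -> r * b = 0) -> exists r, b = r * a.
  move=> h; have [//|[p Pp E]] := divides_or b a.
  exists 0; rewrite mul0r; apply: (annihilator_mul_eq0 hPZ Pp) => r.
  by rewrite -E; exact: h.
apply/finitely_generated_principal.
pose S := [set r : R^o | exists2 A, F A & annihilator A r].
suff -> : \bigcap_(A in F) A = annihilator (submodule_span S).
  exact/hA/span_submodule.
apply/seteqP; split=> [x xF r|x hx A FA].
  apply: (@span_min _ _ S [set r : R^o | x * r = 0]).
    apply/submoduleP; split=> [|a u v /= xu xv]; first exact: mulr0.
    by rewrite mulrDr xv addr0 [a *: u]/(a * u) mulrCA xu mulr0.
  by move=> s [A FA hs] /=; rewrite mulrC; apply: hs; exact: xF.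
have [a AE] := Fp A FA; rewrite AE; apply/cyclic_spanP; apply: dual => r ra.
rewrite mulrC; apply: hx; apply: subset_span; exists A => //.
by rewrite AE annihilator_principal.
Qed.

Lemma translates_countably_generated : ideals_translates ->
  forall A, ideal A -> countably_generated A.
Proof.
move=> [_ h5]; case: (hP) => iP _ _.
have cg1 (a : R^o) : countably_generated (cyclic_span a).
  by exists [set a]; rewrite ?span1.
have cgP : countably_generated P.
  have [[p ->]|nP] := pselect (principal P); first exact: cg1.
  (* Iterating this choice from 0 gives strictly increasing ideals Ru_n. Their union is not
     principal, so it is some Pa, and the q_n in P with q_n a = u_n will generate P. *)
  have next p : exists q, P p -> P q /\ ~ cyclic_span p q.
    have [Pp|nPp] := pselect (P p); last by exists 0.
    apply: contrapT => h; apply: nP; exists p; apply/seteqP; split.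
      by move=> q Pq; apply: contrapT => nq; apply: h; exists q.
    exact: cyclic_span_min.
  have [f fP] := choice next.
  pose u n := iter n f 0.
  have Pu n : P (u n).
    by elim: n => [|n IH]; [exact: submodule0|exact: (fP _ IH).1].
  have uS n : exists2 p, P p & u n = p * u n.+1.
    have [h|//] := divides_or (u n.+1) (u n).
    by case: (fP _ (Pu n)).2; apply/multiplesP.
  have umono n k : exists r, u n = r * u (k + n)%N.
    elim: k => [|k [r E]]; first by exists 1; rewrite mul1r.
    by have [p _ E'] := uS (k + n)%N; exists (r * p); rewrite -mulrA -E'.
  pose A := [set x : R^o | exists n, cyclic_span (u n) x].
  have iA : ideal A.
    apply/submoduleP; split; first by exists 0%N, 0; rewrite ?scale0r.
    move=> a x y [n /cyclic_spanP[r ->]] [m /cyclic_spanP[s ->]].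
    exists (m + n)%N; apply/cyclic_spanP.
    have [t ->] := umono n m; have [v ->] := umono m n.
    rewrite [(n + m)%N]addnC; exists (a * r * t + s * v).
    by rewrite scalerDl -!scalerA.
  have AnP a : ~ A = cyclic_span a.
    move=> AE; have : A a by rewrite AE; exact: cyclic_span_id.
    move=> [n na]; apply: (fP _ (Pu n)).2.
    have : A (u n.+1) by exists n.+1; exact: cyclic_span_id.
    rewrite AE => /cyclic_spanP[r]; rewrite -[f _]/(u n.+1) => ->.
    by apply: submoduleZ => //; exact: cyclic_span_submodule.
  have [a [/AnP//|AE]] := h5 A iA.
  have /choice[q qP] n : exists q, P q /\ q * a = u n.
    have : A (u n) by exists n; exact: cyclic_span_id.
    by rewrite AE => -[q Pq E]; exists q.
  have u1 : u 1%N <> 0.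
    move=> u1; apply: (fP _ (Pu 0%N)).2; rewrite -[f _]/(u 1%N) u1.
    by exists 0; rewrite ?scale0r.
  exists (range q); first exact: card_image_le.
  apply/seteqP; split; last by apply: span_min => // _ [n _ <-]; exact: (qP n).1.
  move=> p Pp; have : A (p * a) by rewrite AE; exists p.
  move=> [n /cyclic_spanP[r E]].
  have iS := span_submodule (range q).
  have Sq m : submodule_span (range q) (q m) by apply: subset_span; exists m.
  rewrite -[p](subrK (r * q n)); apply: (submoduleD iS); last exact: (submoduleZ iS).
  (* p - r q_n kills a but q_1 does not, so q_1 divides p - r q_n. The index is 1 because u_0 =
     0. *)
  have [[t ->]|[t E']] := divides_total hR (p - r * q n) (q 1%N).
    exact: (submoduleZ iS).
  case: u1; rewrite -(qP 1%N).2 E' -mulrA mulrBl E -mulrA (qP n).2.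
  by rewrite [r *: _]/(r * _) subrr mulr0.
move=> A /h5[a [->|->]]; first exact: cg1.
have [S cS PE] := cgP; exists [set s * a | s in S].
  exact: (card_le_trans (card_image_le _ _)).
have iS := span_submodule [set s * a | s in S].
apply/seteqP; split.
  move=> _ [p + <-]; rewrite PE.
  apply: (@span_min _ _ S
    [set p : R^o | submodule_span [set s * a | s in S] (p * a)]).
    apply/submoduleP; split=> [|r x y /= hx hy].
      by rewrite /= mul0r; exact: submodule0.
    rewrite mulrDl; apply: (submoduleD iS) => //.
    by rewrite [r *: x]/(r * x) -mulrA; exact: (submoduleZ iS).
  by move=> s Ss; apply: subset_span; exists s.
apply: span_min; last first.
  by move=> _ [s Ss <-]; exists s => //; rewrite PE; exact: subset_span.
apply/submoduleP; split; first by exists 0; [exact: submodule0|rewrite mul0r].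
move=> r _ _ [p Pp <-] [p' Pp' <-]; exists (r * p + p').
  by apply: (submoduleD iP) => //; exact: (submoduleZ iP).
by rewrite mulrDl -mulrA.
Qed.

End Ideals.

(** * Products and powers of modules; duals of cyclic modules *)

Section Products.
Variables (R : comNzRingType) (P : set R^o).
Hypotheses (hR : valuation_ring R) (hP : maximal_ideal P).
Implicit Types M : lmodType R.

Lemma regular_singly_projective : singly_projective R^o.
Proof.
apply/(singly_projectiveP hR) => x; exists x, 1; split; first exact: esym (mulr1 x).
by move=> r.
Qed.

Lemma regular_flat_content : flat_content R^o.
Proof.
split.
  apply: (torsion_divisible_flat hR) => r x rx; exists x, 1; split=> //.
  exact: esym (mulr1 x).
apply/(content_moduleP hR) => x; exists x, 1; split; first exact: esym (mulr1 x).
by move=> b n ->; exists n; exact: mulrC.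
Qed.

(** Let x = am with a generating the content. If rx = 0, flatness gives x = cn with rc = 0, and c
    divides a, so ra = 0. *)
Lemma flat_content_singly_projective M : flat_content M -> singly_projective M.
Proof.
move=> [/(flat_torsion_divisible hR) dM /(content_moduleP hR) cM].
apply/(singly_projectiveP hR) => x; have [a [m [xE amin]]] := cM x.
exists a, m; split=> // r /dM[c [n [rc /amin[s ->]]]].
by rewrite mulrCA rc mulr0.
Qed.

(** For the content: if x = bn and b does not divide a, then b = pa with p in P. What kills pa kills
    x, hence a, so a = 0. *)
Lemma singly_projective_flat_content M : maximal_zero_divisors P ->
  singly_projective M -> flat_content M.
Proof.
move=> hPZ /(singly_projectiveP hR) spM; split.
  apply: (torsion_divisible_flat hR) => r x rx.
  by have [a [m [xE ha]]] := spM x; exists a, m; split=> //; exact: ha.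
apply/(content_moduleP hR) => x; have [a [m [xE ha]]] := spM x.
exists a, m; split=> // b n E.
have [//|[p Pp bE]] := divides_or hR hP a b.
exists 0; rewrite mul0r; apply: (annihilator_mul_eq0 hR hPZ Pp) => r rpa.
by apply: ha; rewrite E scalerA bE rpa scale0r.
Qed.

(** Write x_i = a_i m_i by the criterion. Tightness of the ideal of the a_i gives d with a_i = b_i
    d; if rx = 0, then r kills all a_i, hence d. *)
Lemma tight_singly_projective_product (I : Type) (M : I -> lmodType R) :
    (forall A : set R^o, ideal A -> tight A) ->
    (forall i, singly_projective (M i)) ->
  singly_projective (prod_module M).
Proof.
move=> ht spM; apply/(singly_projectiveP hR) => x.
have h i : exists a : R, exists m : M i,
    x i = a *: m /\ forall r, r *: x i = 0 -> r * a = 0.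
  exact: (singly_projectiveP hR (M i)).1.
have /choice[a ha] := h.
have [m hm] : exists m : forall i, M i, forall i,
    x i = a i *: m i /\ forall r, r *: x i = 0 -> r * a i = 0.
  by exists (fun i => sval (cid (ha i))) => i; exact: svalP (cid (ha i)).
have [d [sub hd]] := ht _ (span_submodule (range a : set R^o)).
have /choice[b bE] i : exists b : R, a i = b * d.
  by apply/multiplesP; apply: sub; apply: subset_span; exists i.
exists d, (fun i => b i *: m i); split.
  apply: functional_extensionality_dep => i.
  transitivity (d *: (b i *: m i)); last by [].
  by case: (hm i) => -> _; rewrite scalerA [d * _]mulrC -bE; reflexivity.
move=> r rx; apply: hd.
apply: (@span_min _ _ (range a : set R^o) [set c : R^o | r * c = 0]).
  apply/submoduleP; split=> [|s u v /= ru rv]; first exact: mulr0.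
  by rewrite mulrDr rv addr0 [s *: u]/(s * u) mulrCA ru mulr0.
move=> _ [i _ <-] /=; apply: (hm i).2.
by rewrite -[LHS]/((r *: x) i) rx.
Qed.

Lemma power_tight (I : Type) (x : I -> R) :
  singly_projective (prod_module (fun _ : I => R^o)) ->
  tight (submodule_span (range x : set R^o)).
Proof.
move=> /(singly_projectiveP hR)/(_ x)[a [m [xE ha]]]; exists a; split.
  apply: span_min => [|_ [i _ <-]]; first exact: cyclic_span_submodule.
  apply/multiplesP; exists (m i).
  by rewrite mulrC; exact: (congr1 (fun f => f i) xE).
move=> r hr; apply: ha; apply: functional_extensionality_dep => i.
by apply: hr; apply: subset_span; exists i.
Qed.

Lemma full_power_tight : singly_projective (prod_module (fun _ : R => R^o)) ->
  forall A : set R^o, ideal A -> tight A.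
Proof.
move=> sp A iA.
(* Indices in R suffice to list all elements of any ideal; 0 fills the places outside [A]. *)
pose x (r : R) : R := if r \in A then r else 0.
suff -> : A = submodule_span (range x : set R^o).
  exact: power_tight.
apply/seteqP; split.
  by move=> r Ar; apply: subset_span; exists r => //; rewrite /x mem_set.
apply: span_min => // _ [r _ <-].
by rewrite /x; case: ifPn => [/set_mem//|_]; exact: (submodule0 iA).
Qed.

Lemma countable_power_tight (A : set R^o) : countably_generated A ->
  singly_projective (prod_module (fun _ : nat => R^o)) -> tight A.
Proof.
move=> [S /countable_injP[f finj] ->] sp.
(* [x n] is the generator numbered n by [f], or 0 if there is none. *)
have /choice[x xP] n : exists x : R^o, (S x /\ f x = n) \/
    (x = 0 /\ ~ exists2 s, S s & f s = n).
  have [[s Ss sn]|ns] := pselect (exists2 s, S s & f s = n).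
    by exists s; left.
  by exists 0; right.
suff -> : submodule_span S = submodule_span (range x) by exact: power_tight.
apply/seteqP; split; apply: span_min; try exact: span_submodule.
  move=> s Ss; apply: subset_span; exists (f s) => //.
  have [[Sx fx]|[_ []]] := xP (f s); last by exists s.
  by apply: finj => //; exact: mem_set.
move=> _ [n _ <-]; have [[Sx _]|[-> _]] := xP n; first exact: subset_span.
exact: (submodule0 (span_submodule _)).
Qed.

(** With C = Rx and A = (0 : x), a map on C is determined by its value at x, which lies in (0 : A) =
    Rb; so the map sending x to b generates the dual. *)
Lemma annihilators_dual_finitely_generated : annihilators_principal R ->
  forall C : lmodType R, cyclic [set: C] -> finitely_generated [set: dual C].
Proof.
move=> hA C [x xC].
pose A : set R^o := [set r : R^o | (r : R) *: x = 0].
have iA : ideal A.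
  apply/submoduleP; split=> [|a u v /= ux vx]; first exact: scale0r.
  transitivity ((a * u) *: x + v *: x); first exact: scalerDl.
  by rewrite -scalerA ux vx scaler0 addr0.
have [b bE] := hA A iA.
have /choice[c cE] (y : C) : exists c : R, y = c *: x.
  by apply/cyclic_spanP; rewrite -xC.
have Ab r : r *: x = 0 -> r * b = 0.
  have : annihilator A b by rewrite bE; exact: cyclic_span_id.
  by move=> h rx; rewrite mulrC; exact: h.
have lphi : linear (fun y => c y * b : R^o).
  move=> r y z; apply/eqP; rewrite -subr_eq0; apply/eqP.
  rewrite [r *: (_ * _)]mulrA -mulrDl -mulrBl; apply: Ab.
  by rewrite scalerBl scalerDl -scalerA -!cE subrr.
have [phi phiE] := linear_exists lphi.
suff -> : [set: dual C] = cyclic_span (phi : dual C).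
  exact: cyclic_finitely_generated.
apply/seteqP; split=> // psi _.
have : annihilator A ((psi : {linear C -> R^o}) x).
  move=> r rx; rewrite mulrC -[_ * _]/(r *: _) -linearZ.
  by rewrite (_ : _ *: x = 0) ?linear0.
rewrite bE => /multiplesP[t tE]; apply/cyclic_spanP; exists t.
apply: hom_eqP => y.
rewrite -[RHS]/(t * phi y) phiE {1}(cE y) linearZ tE.
by rewrite [LHS]mulrCA.
Qed.

(** Evaluation at the class of 1 maps the dual of R/A onto (0 : A). *)
Lemma dual_finitely_generated_annihilators :
    (forall C : lmodType R, cyclic [set: C] -> finitely_generated [set: dual C]) ->
  forall A : set R^o, ideal A -> finitely_generated (annihilator A).
Proof.
move=> h A iA.
have [C [q [qs qA]]] := quotient_exists iA.
have [|S fS SE] := h C.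
  exists (q 1); apply/seteqP; split=> // y _; have [r <-] := qs y.
  apply/cyclic_spanP; exists r; rewrite -linearZ; congr (q _).
  exact: esym (mulr1 _).
pose ev (phi : dual C) : R^o := (phi : {linear C -> R^o}) (q 1).
exists (ev @` S); first exact: finite_image.
have iS := span_submodule (ev @` S).
apply/seteqP; split.
  move=> r hr.
  have lr : linear (fun s : R^o => s * r : R^o).
    by move=> a u v; rewrite mulrDl -mulrA.
  have [g gE] := linear_exists lr.
  have [|k kE] := quotient_lift (g := g) qs.
    by move=> s /qA As; rewrite gE mulrC; exact: hr.
  have -> : r = ev k by rewrite /ev kE gE mul1r.
  have : submodule_span S (k : dual C) by rewrite -SE.
  apply: (@span_min _ (dual C) S
    [set phi : dual C | submodule_span (ev @` S) (ev phi)]).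
    apply/submoduleP; split=> [|a u v /= hu hv]; first exact: (submodule0 iS).
    by apply: (submoduleD iS) => //; exact: (submoduleZ iS).
  by move=> phi Sphi; apply: subset_span; exists phi.
apply: span_min; first exact: annihilator_ideal.
move=> _ [phi _ <-] a Aa; rewrite mulrC -[_ * _]/(a *: _) -linearZ -linearZ.
have -> : a *: (1 : R^o) = a := mulr1 a.
by rewrite (qA a).2 ?linear0.
Qed.

End Products.

Theorem theorem5p2 (R : comNzRingType) (P : set R^o)
    (hR : valuation_ring R) (hP : maximal_ideal P)
    (hZ : zero_divisors R <> [set 0]) :
  [<->
   (* 1 *)
   forall (I : Type) (M : I -> lmodType R),
     (forall i, singly_projective (M i)) -> singly_projective (prod_module M);
   (* 2 *)
   singly_projective (prod_module (fun _ : R => R^o));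
   (* 3 *)
   forall C : lmodType R, cyclic [set: C] ->
     finitely_generated [set: dual C];
   (* 4 *)
   forall A : set R^o, ideal A -> A <> setT ->
     finitely_generated (annihilator A);
   (* 5 *)
   (principal P \/ faithful P) /\
     forall A : set R^o, ideal A ->
       exists a : R, A = cyclic_span (a : R^o) \/ A = ideal_mulr P a;
   (* 6 *)
   (forall A : set R^o, ideal A -> countably_generated A) /\
     singly_projective (prod_module (fun _ : nat => R^o));
   (* 7 *)
   forall (I : Type) (M : I -> lmodType R),
     (forall i, flat_content (M i)) -> flat_content (prod_module M);
   (* 8 *)
   flat_content (prod_module (fun _ : R => R^o));
   (* 9 *)
   (forall A : set R^o, ideal A -> countably_generated A) /\
     flat_content (prod_module (fun _ : nat => R^o));
   (* 10 *)
   (principal P \/ faithful P) /\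
     forall F : set (set R^o), F !=set0 ->
       (forall A, F A -> principal A) ->
       finitely_generated (\bigcap_(A in F) A)].
Proof.
(* [T] stands for [ideals_translates], [AP] for principal annihilators, [PZ] for P consisting of
   zero-divisors, [SP] and [FC] for singly projective and flat content. *)
have T_AP := fun h : ideals_translates P => tight_annihilators (translates_tight h).
have AP_T := annihilators_translates hR hP hZ.
have tight_T := fun h => AP_T (tight_annihilators h).
have T_PZ := fun h => annihilators_maximal_zero_divisors hR hP hZ (T_AP h).
have T_FC h M := singly_projective_flat_content hR hP (T_PZ h) (M := M).
have T_SP (h : ideals_translates P) I M :=
  tight_singly_projective_product hR (translates_tight h) (I := I) (M := M).
have SP2_T := fun h => tight_T (full_power_tight hR h).
have SP6_T : (forall A : set R^o, ideal A -> countably_generated A) /\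
    singly_projective (prod_module (fun _ : nat => R^o)) -> ideals_translates P.
  move=> [cg sp]; apply: tight_T => A /cg cA.
  exact: (countable_power_tight hR cA sp).
have FC_SP := flat_content_singly_projective hR.
tfae.
- by apply=> i; exact: (regular_singly_projective hR).
- move=> /SP2_T/T_AP; exact: annihilators_dual_finitely_generated.
- by move=> h A iA _; exact: dual_finitely_generated_annihilators.
- move=> h; apply: AP_T => A iA; apply/(finitely_generated_principal hR).
  (* The hypothesis covers proper ideals only; the annihilator of R itself is generated by 0. *)
  have [->|AT] := pselect (A = setT); last exact: h.
  apply/(finitely_generated_principal hR); exists 0; apply/seteqP; split.
    by move=> r /(_ 1 I); rewrite mulr1 => ->; exact: cyclic_span_id.
  by move=> _ [r _ <-] a _; rewrite scaler0 mul0r.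
- move=> h; split; first
    exact: (translates_countably_generated hR hP h).
  by apply: (T_SP h) => i; exact: (regular_singly_projective hR).
- move=> /SP6_T h I M fM; apply: (T_FC h); apply: (T_SP h) => i.
  exact/FC_SP/fM.
- by apply=> i; exact: (regular_flat_content hR).
- move=> /FC_SP/SP2_T h; split; first
    exact: (translates_countably_generated hR hP h).
  by apply: (T_FC h); apply: (T_SP h) => i; exact: (regular_singly_projective hR).
- move=> [cg /FC_SP sp]; have h := SP6_T (conj cg sp); split; first exact: h.1.
  move=> F _ Fp; exact: (annihilators_intersections hR hP hZ (T_AP h)).
- move=> [hpf hF]; apply: (T_SP (intersections_translates hR hP hpf hF)).
Qed.
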